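(* Let $g\in M(I)$, let $\mathcal{G}=\mathcal{G}_g$ be the ultragraph induced by $g$, and let $x\in E_g$. Then the map $\nu_x:C^*(\mathcal{G},\emptyset)\to B(\ell^2(R_g(x)))$ determined by $\nu_x(p_B)=W_B$ for $B\in\mathcal{E}$ and $\nu_x(s_{e_i})=T_{e_i}$ for $i\in\mathbb{N}$ is a ($\,$well-defined$\,$) $*$-homomorphism.
   Context: $\mathbb{N}=\{1,2,\dots\}$. Let $I=[a,b)$ with $a\in\mathbb{R}$, $b\in\mathbb{R}\cup\{\infty\}$. A map $g$ belongs to the Markov class $M(I)$ if: (1) there are closed intervals $(I_n)_{n\in\mathbb{N}}$ with $\max(I_j)\le\min(I_{j+1})$, $|I_i\cap I_j|\le1$ for $i\neq j$, $\mathrm{dom}(g)=\bigcup_nI_n\subseteq I$, $\min(I_1)=a$ and $\sup(I_n)\to b$; (2) $g|_{\mathring{I_i}}$ is injective for each $i$ ($\mathring{I_i}$ is the interior), $\mathrm{Im}(g)\subseteq I$ and $g(\Gamma)\subseteq\Gamma$, where $\Gamma=\bigcup_n\partial I_n$; (3) for every $i$, $g(I_i)\cap\bigcup_nI_n$ is a nonempty union of intervals of the form $I_n$. Let $g_i=g|_{I_i}$ and let the escape sets be $E_n=(\max I_n,\min I_{n+1})$ (possibly empty), so $I=\bigcup_nI_n\cup\bigcup_nE_n$. The ultragraph $\mathcal{G}_g$ has vertices $\{v_i:i\in\mathbb{N}\}$, edges $\{e_i:i\in\mathbb{N}\}$, source $s(e_i)=v_i$ and range the set $r(e_i)=\{v_j:\mathring{I_j}\subseteq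 g(\mathring{I_i})\}$. $\mathcal{E}$ is the smallest family of subsets of $\mathcal{G}^0$ containing $\emptyset$, all $\{v_i\}$ and all $r(e_i)$, closed under finite unions and finite intersections. $C^*(\mathcal{G},\emptyset)$ is the universal $C^*$-algebra generated by partial isometries $s_e$ ($e\in\mathcal{G}^1$) with mutually orthogonal ranges and projections $p_A$ ($A\in\mathcal{E}$) with $p_\emptyset=0$, $p_Ap_B=p_{A\cap B}$, $p_{A\cup B}=p_A+p_B-p_{A\cap B}$, $s_e^*s_e=p_{r(e)}$, $s_es_e^*\le p_{\{s(e)\}}$. $E_g=\bigcup_{k\in\mathbb{N}}g^{-k}\bigl(\bigcup_jE_j\bigr)$. For $x\in E_g$ let $\tau(x)\in\mathbb{N}$ be the unique number with $g^{\tau(x)-1}(x)\in\mathrm{dom}(g)$ and $g^{\tau(x)}(x)\notin\mathrm{dom}(g)$ ($g^0(x)=x$), and $R_g(x)=\{y\in\mathrm{dom}(g):g^n(y)=g^{\tau(x)}(x)\text{ for some }n\in\mathbb{N}\}$. $\ell^2(R_g(x))$ has orthonormal basis $\{\delta_y:y\in R_g(x)\}$. Define bounded operators by $W_B(\delta_y)=\chi_{\bigcup_{\{j:v_j\in B\}}I_j}(y)\,\delta_y$ and $T_{e_i}(\delta_y)=\chi_{\bigcup_{\{j:v_j\in r(e_i)\}}I_j}(y)\,\delta_{g_i^{-1}(y)}$, where, when the characteristic function is nonzero, $g_i^{-1}(y)$ is the unique preimage of $y$ under $g$ in $I_i$ (it lies in $\mathring{I_i}\cap R_g(x)$). *)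

(* Defs.v *)
From HB Require Import structures.
From mathcomp Require Import all_boot all_order all_algebra.
From mathcomp Require Import finmap complex.
From mathcomp Require Import all_classical all_reals all_analysis.
From mathcomp Require Import ring.
From mathcomp.analysis.showcase Require summability.
Import numFieldNormedType.Exports.

Set Implicit Arguments.
Unset Strict Implicit.
Unset Printing Implicit Defensive.

Import Order.TTheory GRing.Theory Num.Theory.
Local Open Scope classical_set_scope.
Local Open Scope ring_scope.

(* Not necessarily unital, hence not built on the (unital) rings of ssralg.
   The norm takes its values in R[i], as for any normed module over R[i]. *)
Record cstarAlgebra (R : realType) := CStarAlgebra {
  cstar_sort :> completeNormedModType R[i] ;
  cmul : cstar_sort -> cstar_sort -> cstar_sort ;
  cstar : cstar_sort -> cstar_sort ;
  cmulA : associative cmul ;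
  cmulDl : left_distributive cmul +%R ;
  cmulDr : right_distributive cmul +%R ;
  cmulZl : forall (k : R[i]) a b, cmul (k *: a) b = k *: cmul a b ;
  cmulZr : forall (k : R[i]) a b, cmul a (k *: b) = k *: cmul a b ;
  cstarK : involutive cstar ;
  cstarD : {morph cstar : a b / a + b} ;
  cstarZ : forall (k : R[i]) a, cstar (k *: a) = conjc k *: cstar a ;
  cstarM : forall a b, cstar (cmul a b) = cmul (cstar b) (cstar a) ;
  cnormM : forall a b, `|cmul a b| <= `|a| * `|b| ;
  cnorm_star : forall a, `|cmul (cstar a) a| = `|a| ^+ 2
}.

Section CStarTheory.
Context {R : realType}.
Implicit Types A B : cstarAlgebra R.

Definition cle A (a b : A) : Prop := exists c : A, b - a = cmul (cstar c) c.

Definition is_projection A (p : A) : Prop := cmul p p = p /\ cstar p = p.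

Definition is_partial_isometry A (s : A) : Prop :=
  cmul (cmul s (cstar s)) s = s.

Record is_star_hom A B (phi : A -> B) : Prop := {
  star_hom_linear : linear phi ;
  star_homM : forall a b, phi (cmul a b) = cmul (phi a) (phi b) ;
  star_hom_star : forall a, phi (cstar a) = cstar (phi a)
}.

End CStarTheory.

Record ultragraph := Ultragraph {
  vertex : Type ;
  edge : Type ;
  source : edge -> vertex ;
  range_set : edge -> set vertex
}.

Inductive gen_vertex_set (G : ultragraph) : set (vertex G) -> Prop :=
| gvs_empty : gen_vertex_set set0
| gvs_vertex (v : vertex G) : gen_vertex_set [set v]
| gvs_range (e : edge G) : gen_vertex_set (range_set e)
| gvs_union (A B : set (vertex G)) :
    gen_vertex_set A -> gen_vertex_set B -> gen_vertex_set (A `|` B)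
| gvs_inter (A B : set (vertex G)) :
    gen_vertex_set A -> gen_vertex_set B -> gen_vertex_set (A `&` B).

Section UltragraphAlgebra.
Context {R : realType} (G : ultragraph).

(* The values of [p] outside [gen_vertex_set G] are irrelevant. *)
Record ultragraph_family (A : cstarAlgebra R)
    (s : edge G -> A) (p : set (vertex G) -> A) : Prop := {
  uf_partial_isometry : forall e, is_partial_isometry (s e) ;
  uf_orthogonal : forall e f, e <> f ->
    cmul (cmul (s e) (cstar (s e))) (cmul (s f) (cstar (s f))) = 0 ;
  uf_projection : forall X, gen_vertex_set X -> is_projection (p X) ;
  uf_empty : p set0 = 0 ;
  uf_inter : forall X Y, gen_vertex_set X -> gen_vertex_set Y ->
    cmul (p X) (p Y) = p (X `&` Y) ;
  uf_union : forall X Y, gen_vertex_set X -> gen_vertex_set Y ->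
    p (X `|` Y) = p X + p Y - p (X `&` Y) ;
  uf_range : forall e, cmul (cstar (s e)) (s e) = p (range_set e) ;
  uf_source : forall e, cle (cmul (s e) (cstar (s e))) (p [set source e])
}.

Definition is_ultragraph_algebra (A : cstarAlgebra R)
    (s : edge G -> A) (p : set (vertex G) -> A) : Prop :=
  ultragraph_family s p /\
  forall (B : cstarAlgebra R) (s' : edge G -> B) (p' : set (vertex G) -> B),
    ultragraph_family s' p' ->
    exists! phi : A -> B,
      [/\ is_star_hom phi,
          forall e, phi (s e) = s' e &
          forall X, gen_vertex_set X -> phi (p X) = p' X].

End UltragraphAlgebra.

Section L2.
Context {R : realType} {T : choiceType}.

Definition sqr_mod (z : R[i]) : R := complex.Re z ^+ 2 + complex.Im z ^+ 2.

Definition sqr_sum (f : T -> R[i]) : \bar R :=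
  (\esum_(t in [set: T]) (sqr_mod (f t))%:E)%E.

Definition sqr_summable : pred (T -> R[i]^o) :=
  fun f => `[< (sqr_sum f < +oo)%E >].

Lemma sqr_mod_ge0 (z : R[i]) : 0 <= sqr_mod z.
Proof. by rewrite addr_ge0// sqr_ge0. Qed.

Lemma sqr_mod0 : sqr_mod 0 = 0.
Proof. by rewrite /sqr_mod /= expr0n addr0. Qed.

Lemma sqr_modM (z w : R[i]) : sqr_mod (z * w) = sqr_mod z * sqr_mod w.
Proof. by case: z w => [a b] [c d]; rewrite /sqr_mod /=; ring. Qed.

Lemma sqr_modD_le (z w : R[i]) :
  sqr_mod (z + w) <= 2 * sqr_mod z + 2 * sqr_mod w.
Proof.
case: z w => [a b] [c d]; rewrite /sqr_mod /= -subr_ge0.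
rewrite (_ : _ - _ = (a - c) ^+ 2 + (b - d) ^+ 2); last by ring.
by rewrite addr_ge0// sqr_ge0.
Qed.

Lemma sqr_summable_submod : submod_closed sqr_summable.
Proof.
have scale_lty (k : R) (f : T -> R[i]) : 0 <= k -> (sqr_sum f < +oo)%E ->
    (\esum_(t in [set: T]) (k * sqr_mod (f t))%:E < +oo)%E.
  move=> k0 fy; apply: (@le_lt_trans _ _ (k%:E * sqr_sum f)%E); last first.
    by apply: lte_mul_pinfty.
  apply: ge_ereal_sup => _ [F [Ffin _] <-].
  under eq_fsbigr do rewrite EFinM.
  rewrite -ge0_mule_fsumr; last by move=> t; rewrite lee_fin sqr_mod_ge0.
  by rewrite lee_wpmul2l// ?lee_fin// ereal_sup_ubound//; exists F.
split.
  apply/asboolP; rewrite /sqr_sum esum1// => t _.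
  by rewrite [in X in _ = X]/= (_ : sqr_mod _ = 0) //; exact: sqr_mod0.
move=> k f g /asboolP fy /asboolP gy; apply/asboolP.
apply: (@le_lt_trans _ _ (\esum_(t in [set: T])
    ((2 * sqr_mod k * sqr_mod (f t))%:E + (2 * sqr_mod (g t))%:E))%E).
  apply: le_esum => t _; rewrite -EFinD lee_fin.
  apply: le_trans (sqr_modD_le _ _) _.
  by rewrite /GRing.scale/= sqr_modM mulrA.
rewrite esumD; [|by move=> t _; rewrite lee_fin !mulr_ge0 ?sqr_mod_ge0..].
by rewrite lte_add_pinfty// scale_lty// ?mulr_ge0 ?sqr_mod_ge0.
Qed.

HB.instance Definition _ :=
  GRing.isSubmodClosed.Build R[i] (T -> R[i]^o) sqr_summable
    sqr_summable_submod.

End L2.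

Record l2 (R : realType) (T : choiceType) := L2 {
  l2_fun :> T -> R[i]^o ;
  l2_funP : l2_fun \in @sqr_summable R T
}.

Section L2Space.
Context {R : realType} {T : choiceType}.

HB.instance Definition _ := [isSub for @l2_fun R T].
HB.instance Definition _ := [Choice of l2 R T by <:].
HB.instance Definition _ := [SubChoice_isSubLmodule of l2 R T by <:].

Definition l2_norm (f : l2 R T) : R := Num.sqrt (fine (sqr_sum f)).

(* The sum is the limit along the net of the finite subsets of [T]. *)
Definition l2_dot (f g : l2 R T) : R[i] :=
  summability.sum (fun t => f t * conjc (g t) : R[i]^o).

Lemma delta_subproof (y : T) :
  (fun t => (t == y)%:R : R[i]^o) \in @sqr_summable R T.
Proof.
apply/asboolP; rewrite /sqr_sum.
rewrite (_ : (\esum_(t in _) _)%E = (\esum_(t in [set y]) 1)%E).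
  by rewrite esum_set1// ltry.
rewrite (esum_mkcond [set y]); apply: eq_esum => t _; case: ifPn.
  by rewrite inE => ->; rewrite eqxx /sqr_mod /= expr1n expr0n addr0.
rewrite notin_setE => ty; rewrite (negbTE (introN eqP ty)).
by rewrite sqr_mod0.
Qed.

Definition l2_delta (y : T) : l2 R T := L2 (delta_subproof y).

End L2Space.

Record bounded_operator (R : realType) (T : choiceType) := BoundedOperator {
  bop_fun :> l2 R T -> l2 R T ;
  bop_linear : linear bop_fun ;
  bop_bounded : exists M : R, forall f, l2_norm (bop_fun f) <= M * l2_norm f
}.

Section StarRepresentation.
Context {R : realType} {T : choiceType} {A : cstarAlgebra R}.

(* The *-homomorphisms A -> B(l^2(T)), the *-algebra structure of B(l^2(T))
   being given by pointwise operations, composition and adjoints. *)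
Record is_star_representation (nu : A -> bounded_operator R T) : Prop := {
  star_repD : forall a b f, nu (a + b) f = nu a f + nu b f ;
  star_repZ : forall (k : R[i]) a f, nu (k *: a) f = k *: nu a f ;
  star_repM : forall a b f, nu (cmul a b) f = nu a (nu b f) ;
  star_rep_star : forall a f h, l2_dot (nu a f) h = l2_dot f (nu (cstar a) h)
}.

End StarRepresentation.

(* Indices start at 0 instead of 1: [lo n] and [hi n] are the endpoints of
   the interval I_(n+1). A map g : dom(g) -> R is represented by a total
   function, whose values outside [markov_dom] are never used. *)
Section Markov.
Context {R : realType}.
Variables (a : R) (b : \bar R) (lo hi : nat -> R) (g : R -> R).

Definition half_open : set R := [set t | a <= t /\ (t%:E < b)%E].

Definition piece (n : nat) : set R := [set t | lo n <= t <= hi n].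

Definition markov_dom : set R := \bigcup_n piece n.

Definition boundary (X : set R) : set R := closure X `\` X^°.

Definition markov_boundary : set R := \bigcup_n boundary (piece n).

Record markov_class : Prop := {
  piece_nonempty : forall n, lo n <= hi n ;
  piece_ordered : forall n, hi n <= lo n.+1 ;
  piece_meet : forall i j, i <> j -> is_subset1 (piece i `&` piece j) ;
  markov_dom_sub : markov_dom `<=` half_open ;
  markov_start : lo 0 = a ;
  markov_end : (hi n)%:E @[n --> \oo] --> b ;
  markov_inj : forall n, set_inj (piece n)^° g ;
  markov_image : g @` markov_dom `<=` half_open ;
  markov_boundary_stable : g @` markov_boundary `<=` markov_boundary ;
  markov_property : forall i, exists2 J : set nat, J !=set0 &
    g @` piece i `&` markov_dom = \bigcup_(j in J) piece j
}.

Definition escape_set (n : nat) : set R := [set t | hi n < t < lo n.+1].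

Definition markov_ultragraph : ultragraph := {|
  vertex := nat ;
  edge := nat ;
  source := fun i => i ;
  range_set := fun i => [set j | (piece j)^° `<=` g @` (piece i)^°]
|}.

(* g^n(y), which is [iter n g y], makes sense for the partial map g. *)
Definition iter_defined (n : nat) (y : R) : Prop :=
  forall k, (k < n)%N -> markov_dom (iter k g y).

Definition escaping_points : set R :=
  \bigcup_(k in [set k | (0 < k)%N])
    [set x | iter_defined k x /\ (\bigcup_j escape_set j) (iter k g x)].

Definition is_escape_time (x : R) (k : nat) : Prop :=
  [/\ (0 < k)%N, iter_defined k x,
      markov_dom (iter k.-1 g x) & ~ markov_dom (iter k g x)].

(* Meaningful for [x] in [escaping_points], where the escape time exists and
   is unique. *)
Definition escape_time (x : R) : nat := xget 0%N (is_escape_time x).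

Definition escape_orbit (x : R) : set R :=
  [set y | markov_dom y /\ exists n,
     [/\ (0 < n)%N, iter_defined n y &
         iter n g y = iter (escape_time x) g x]].

Variable x : R.
Local Notation orb := (escape_orbit x).

(* [xget] falls back on [y] when there is no such preimage; its uses below are
   restricted by the characteristic function to those [y] that have one. *)
Definition branch_inverse (i : nat) (y : orb) : orb :=
  xget y [set z : orb | piece i (set_val z) /\ g (set_val z) = set_val y].

Definition union_pieces (B : set nat) : set R := \bigcup_(j in B) piece j.

Definition is_W (B : set nat) (W : bounded_operator R orb) : Prop :=
  forall y : orb,
    W (l2_delta y) = (\1_(union_pieces B) (set_val y) : R[i]) *: l2_delta y.

Definition is_T (i : nat) (U : bounded_operator R orb) : Prop :=
  forall y : orb,
    U (l2_delta y) =
      (\1_(union_pieces (@range_set markov_ultragraph i)) (set_val y) : R[i])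
        *: l2_delta (branch_inverse i y).

End Markov.

(* Main.v *)
Require Import Defs.
From HB Require Import structures.
From mathcomp Require Import all_boot all_order all_algebra.
From mathcomp Require Import finmap complex.
From mathcomp Require Import all_classical all_reals all_analysis.
From mathcomp Require Import ring lra.
From mathcomp.analysis.showcase Require summability.
Import numFieldNormedType.Exports.
Import Order.TTheory GRing.Theory Num.Theory.
Local Open Scope classical_set_scope.
Local Open Scope ring_scope.
Local Open Scope complex_scope.

Set Implicit Arguments.
Unset Strict Implicit.
Unset Printing Implicit Defensive.

(** Write H for the space of square-summable families on the orbit of the
    escaping point.  The universal algebra only maps into C*-algebras, so B(H)
    has to be exhibited as one; then the theorem amounts to checking the
    ultragraph relations for the operators W_B and T_i.

    The C*-algebra.  The inner product is defined as a limit of finite sums.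
    Polarization writes each such sum as a combination of finite sums of
    squared moduli, which are monotone, so the limit exists and is an explicit
    combination of squared norms ([cvg_l2_dot_polar]).  B(H) is realized as the algebra [adjop_algebra] of
    the bounded operators that have an adjoint.  The adjoint makes them linear,
    and it makes them determined by their values on the basis vectors
    ([adjop_delta_inj]), because the matrix coefficients of an operator are
    the conjugates of those of its adjoint, and the adjoint recovers the
    operator on every vector.  A Cauchy filter of operators converges
    entrywise; the bounds on finite partial sums pass to the limit, and the
    limits of the operators and of their adjoints are again adjoint to each
    other ([adjop_complete]).

    The operators.  W_B is the multiplication by an indicator function, and
    T_i is the composition with a bijection between two parts of the orbit,
    extended by zero.  Both are operators [shift_op], whose products with
    their adjoints are the multiplications by the indicators of the two parts.
    The ultragraph relations thus become identities between subsets of the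
    orbit ([orbit_family]).  They hold since no point of the orbit lies on the
    boundary of a piece: the boundary is invariant under g and contained in
    dom(g), whereas every point of the orbit leaves dom(g)
    ([orbit_interior]).  Hence each point of the orbit lies in exactly one
    piece, and g is injective on the orbit points of each piece.

    Existence is then the universal property applied to this family.  For
    uniqueness, every *-representation on H by bounded operators is a
    *-homomorphism into [adjop_algebra] ([representation_star_hom]), and on
    the generators it is determined by the values on basis vectors, so the
    uniqueness part of the universal property applies. *)

#[local] Existing Instance summability.totally_filter.

(** * Square-summable families and their finite partial sums *)

Section Sums.
Context {R : realType} {T : choiceType}.
Implicit Types f h : T -> R[i].

(** The squared l^2-norm. *)
Definition sqn f : R := fine (sqr_sum f).

Lemma sqr_sum_ge0 f : (0 <= sqr_sum f)%E.
Proof. by apply: esum_ge0 => t _; rewrite lee_fin sqr_mod_ge0. Qed.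

Lemma sqn_ge0 f : 0 <= sqn f.
Proof. exact/fine_ge0/sqr_sum_ge0. Qed.

Lemma sqnE f : (sqr_sum f < +oo)%E -> sqr_sum f = (sqn f)%:E.
Proof. by move=> ?; rewrite fineK// ge0_fin_numE// sqr_sum_ge0. Qed.

Lemma posc_real (e : R[i]) : 0 < e -> 0 < complex.Re e /\ e = (complex.Re e)%:C.
Proof.
case: e => u v; rewrite ltcE/= => /andP[/eqP -> u0].
by split.
Qed.

Lemma partial_sum_fset (V : zmodType) (u : T -> V) (A : {fset T}) :
  summability.partial_sum u A = \sum_(i <- A) u i.
Proof. by rewrite /summability.partial_sum big_seq_fsetE. Qed.

Lemma fsum_sqr f (A : {fset T}) :
  (\sum_(t \in [set` A]) (sqr_mod (f t))%:E = (\sum_(t <- A) sqr_mod (f t))%:E)%E.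
Proof. by rewrite fsbig_finite//= set_fsetK sumEFin. Qed.

Lemma sum_le_sqn f (A : {fset T}) : (sqr_sum f < +oo)%E ->
  \sum_(t <- A) sqr_mod (f t) <= sqn f.
Proof.
move=> fy; rewrite -lee_fin -sqnE// -fsum_sqr.
by apply: ereal_sup_ubound; exists [set` A] => //; split.
Qed.

Lemma sqr_sum_le f (M : R) : (forall A : {fset T}, \sum_(t <- A) sqr_mod (f t) <= M) ->
  (sqr_sum f <= M%:E)%E.
Proof.
move=> fM; apply: ge_ereal_sup => _ [F [Ffin _] <-].
by rewrite -(fset_setK Ffin) fsum_sqr lee_fin.
Qed.

Lemma sqn_adherent f (e : R) : (sqr_sum f < +oo)%E -> 0 < e ->
  exists A : {fset T}, sqn f - e < \sum_(t <- A) sqr_mod (f t).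
Proof.
move=> fy e0; apply: contrapT => /forallNP H.
suff /sqr_sum_le : forall A : {fset T}, \sum_(t <- A) sqr_mod (f t) <= sqn f - e.
  by rewrite sqnE// lee_fin; lra.
by move=> A; rewrite leNgt; exact/negP.
Qed.

(** The partial sums increase, so once one of them exceeds [sqn f - e], all
    later ones stay within [e] of [sqn f]. *)
Lemma cvg_sqr_sum f : (sqr_sum f < +oo)%E ->
  summability.partial_sum (fun t => (sqr_mod (f t))%:C : R[i]^o) @
    summability.totally --> ((sqn f)%:C : R[i]^o).
Proof.
move=> fy; apply/cvgrPdist_lt => e /posc_real[e0 ->].
have [A Af] := sqn_adherent fy e0.
exists A => // B /= AB.
rewrite partial_sum_fset -(rmorph_sum (real_complex R)) -rmorphB normc_def /=.
rewrite expr0n addr0 sqrtr_sqr ltcR ger0_norm ?subr_ge0 ?sum_le_sqn//.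
rewrite ltrBlDr -ltrBlDl; apply: lt_le_trans Af _.
rewrite (big_fsetID _ (mem A) B)/=.
have -> : [fset x | x in B & x \in A]%fset = A.
  apply/fsetP => t; rewrite !inE /=; case: (boolP (t \in A)); rewrite ?andbF ?andbT//.
  exact: (fsubsetP AB).
by rewrite lerDl sumr_ge0// => t _; rewrite sqr_mod_ge0.
Qed.
End Sums.

(** * The inner product of l^2 *)

Section Dot.
Context {R : realType} {T : choiceType}.
Implicit Types (f h : l2 R T) (k : R[i]).
Local Notation C := (R[i]^o).

Lemma l2_lty f : (sqr_sum f < +oo)%E.
Proof. exact: asboolW (l2_funP f). Qed.

Lemma l2P f h : (forall t, f t = h t) -> f = h.
Proof. by move=> fh; apply/val_inj/funext. Qed.

(** The identity that reduces all the convergence questions about the inner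
    product to sums of nonnegative terms. *)
Lemma polarization (z w : R[i]) : z * conjc w =
  4^-1 * ((sqr_mod (z + w))%:C - (sqr_mod (z - w))%:C +
    'i * (sqr_mod (z + 'i * w))%:C - 'i * (sqr_mod (z - 'i * w))%:C).
Proof.
apply: (@mulfI _ 4); first by rewrite pnatr_eq0.
rewrite mulVKf ?pnatr_eq0//.
have -> : 4 = (4%:R : R)%:C :> R[i] by rewrite rmorph_nat.
case: z w => [a b] [c d]; rewrite /sqr_mod /=; simpc => /=.
by congr (_ +i* _); ring.
Qed.

Lemma cvg_l2_dot_polar f h :
  summability.partial_sum (fun t => f t * conjc (h t) : C) @ summability.totally -->
  (4^-1 *: ((sqn (f + h))%:C - (sqn (f - h))%:C +
    'i *: (sqn (f + 'i *: h))%:C - 'i *: (sqn (f - 'i *: h))%:C) : C).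
Proof.
have -> : summability.partial_sum (fun t => f t * conjc (h t) : C) =
   4^-1 \*: (summability.partial_sum (fun t => (sqr_mod ((f + h) t))%:C : C)
      \- summability.partial_sum (fun t => (sqr_mod ((f - h) t))%:C : C)
      \+ 'i \*: summability.partial_sum (fun t => (sqr_mod ((f + 'i *: h) t))%:C : C)
      \- 'i \*: summability.partial_sum (fun t => (sqr_mod ((f - 'i *: h) t))%:C : C)).
  apply/funext => A /=; rewrite !partial_sum_fset !scaler_sumr.
  rewrite -!sumrB -big_split/= -sumrB scaler_sumr; apply: eq_bigr => t _.
  exact: polarization.
apply: cvgZr; apply: cvgB; last by apply: cvgZr; exact/cvg_sqr_sum/l2_lty.
apply: cvgD; last by apply: cvgZr; exact/cvg_sqr_sum/l2_lty.
by apply: cvgB; exact/cvg_sqr_sum/l2_lty.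
Qed.

Lemma cvg_l2_dot f h :
  summability.partial_sum (fun t => f t * conjc (h t) : C) @ summability.totally -->
  (l2_dot f h : C).
Proof. by have /cvgP := @cvg_l2_dot_polar f h. Qed.

Lemma l2_dot_polar f h : l2_dot f h =
  (4^-1 *: ((sqn (f + h))%:C - (sqn (f - h))%:C +
    'i *: (sqn (f + 'i *: h))%:C - 'i *: (sqn (f - 'i *: h))%:C) : C).
Proof. by rewrite /l2_dot /summability.sum; apply: (cvg_lim (@norm_hausdorff _ C)); exact: cvg_l2_dot_polar. Qed.

Lemma l2_dotP f f' h k : l2_dot (k *: f + f') h = k * l2_dot f h + l2_dot f' h.
Proof.
rewrite /l2_dot /summability.sum; apply: (cvg_lim (@norm_hausdorff _ C)).
have -> : summability.partial_sum (fun t => (k *: f + f') t * conjc (h t) : C) =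
   k \*: summability.partial_sum (fun t => f t * conjc (h t) : C)
   \+ summability.partial_sum (fun t => f' t * conjc (h t) : C).
  apply/funext => A /=; rewrite !partial_sum_fset scaler_sumr -big_split/=.
  by apply: eq_bigr => t _; rewrite mulrDl -scalerAl.
by apply: cvgD; [apply: cvgZr|]; exact: cvg_l2_dot.
Qed.

Lemma l2_dotC f h : l2_dot h f = conjc (l2_dot f h).
Proof.
rewrite [LHS]/l2_dot /summability.sum; apply: (cvg_lim (@norm_hausdorff _ C)).
have -> : summability.partial_sum (fun t => h t * conjc (f t) : C) =
    conjc \o summability.partial_sum (fun t => f t * conjc (h t) : C).
  apply/funext => A /=; rewrite !partial_sum_fset (rmorph_sum conjc).
  by apply: eq_bigr => t _; rewrite rmorphM/= conjcK mulrC.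
apply/cvgrPdist_lt => e e0; have /cvgrPdist_lt/(_ e e0) := @cvg_l2_dot f h.
by apply: filterS => A; rewrite /= -(rmorphB conjc) normcJ.
Qed.

Lemma l2_dotDl f f' h : l2_dot (f + f') h = l2_dot f h + l2_dot f' h.
Proof. by have := l2_dotP f f' h 1; rewrite scale1r mul1r. Qed.

Lemma l2_dot0l h : l2_dot 0 h = 0.
Proof. by apply: (addrI (l2_dot 0 h)); rewrite -l2_dotDl !addr0. Qed.

Lemma l2_dotZl k f h : l2_dot (k *: f) h = k * l2_dot f h.
Proof. by have := l2_dotP f 0 h k; rewrite addr0 l2_dot0l addr0. Qed.

Lemma l2_dotBl f f' h : l2_dot (f - f') h = l2_dot f h - l2_dot f' h.
Proof. by rewrite l2_dotDl -scaleN1r l2_dotZl mulN1r. Qed.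

Lemma l2_dotBr f h h' : l2_dot f (h - h') = l2_dot f h - l2_dot f h'.
Proof. by rewrite l2_dotC l2_dotBl rmorphB/= -!l2_dotC. Qed.

Lemma l2_dotDr f h h' : l2_dot f (h + h') = l2_dot f h + l2_dot f h'.
Proof. by rewrite l2_dotC l2_dotDl rmorphD/= -!l2_dotC. Qed.

Lemma l2_dotZr k f h : l2_dot f (k *: h) = conjc k * l2_dot f h.
Proof. by rewrite l2_dotC l2_dotZl rmorphM/= -!l2_dotC. Qed.

Lemma l2_dotff f : l2_dot f f = (sqn f)%:C.
Proof.
rewrite /l2_dot /summability.sum; apply: (cvg_lim (@norm_hausdorff _ C)).
rewrite (_ : (fun t => _) = (fun t => (sqr_mod (f t))%:C : C)); last first.
  apply/funext => t; rewrite /sqr_mod -[RHS]/(_%:C); case: (f t) => u v /=; simpc.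
  by congr (_ +i* _); ring.
exact/cvg_sqr_sum/l2_lty.
Qed.

Lemma l2_dot_delta f y : l2_dot f (l2_delta y) = f y.
Proof.
rewrite /l2_dot /summability.sum; apply: (cvg_lim (@norm_hausdorff _ C)); apply: cvg_near_cst.
exists [fset y]%fset => // A /= /fsubsetP yA.
rewrite partial_sum_fset (big_fsetD1 y)/=; last by apply: yA; rewrite inE.
rewrite eqxx conjc1 mulr1 big1_fset ?addr0// => t; rewrite !inE => /andP[/negPf -> _] _.
by rewrite conjc0 mulr0.
Qed.

Lemma l2_dot_inj f f' : (forall h, l2_dot f h = l2_dot f' h) -> f = f'.
Proof. by move=> ff'; apply: l2P => t; rewrite -!l2_dot_delta. Qed.

Lemma sqr_mod_le_sqn f t : sqr_mod (f t) <= sqn f.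
Proof. by have := sum_le_sqn [fset t]%fset (l2_lty f); rewrite big_seq_fset1. Qed.

Lemma sqr_mod_eq0 (z : R[i]) : sqr_mod z = 0 -> z = 0.
Proof.
case: z => u v /eqP; rewrite /sqr_mod /= paddr_eq0 ?sqr_ge0// !sqrf_eq0.
by move=> /andP[/eqP -> /eqP ->].
Qed.

Lemma sqn_eq0 f : sqn f = 0 -> f = 0.
Proof.
move=> f0; apply: l2P => t; apply: sqr_mod_eq0; apply/eqP.
by rewrite eq_le sqr_mod_ge0 -f0 sqr_mod_le_sqn.
Qed.

Lemma mulc_conjc (z : R[i]) : z * conjc z = (sqr_mod z)%:C.
Proof. by case: z => u v; rewrite /sqr_mod /=; simpc; congr (_ +i* _); ring. Qed.

Lemma sqnZ k f : sqn (k *: f) = sqr_mod k * sqn f.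
Proof.
apply: (@complexI R); rewrite -l2_dotff l2_dotZl l2_dotZr mulrA mulc_conjc.
by rewrite l2_dotff rmorphM.
Qed.

(** Expand the squared norm of [sqn h *: f - <f, h> *: h], which is
    nonnegative. *)
Lemma cauchy_schwarz_sqr f h : sqr_mod (l2_dot f h) <= sqn f * sqn h.
Proof.
have [/sqn_eq0 ->|h0] := eqVneq (sqn h) 0.
  by rewrite l2_dotC l2_dot0l conjc0 sqr_mod0 mulr_ge0// sqn_ge0.
have {}h0 : 0 < sqn h by rewrite lt_def h0 sqn_ge0.
set c := l2_dot f h.
have := sqn_ge0 ((sqn h)%:C *: f - c *: h : l2 R T).
suff -> : sqn ((sqn h)%:C *: f - c *: h : l2 R T) =
    sqn h * (sqn f * sqn h - sqr_mod c) by rewrite pmulr_rge0// subr_ge0.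
apply: (@complexI R); rewrite -(l2_dotff ((sqn h)%:C *: f - c *: h)) l2_dotBl !l2_dotBr !l2_dotZl !l2_dotZr.
rewrite !l2_dotff [l2_dot h f]l2_dotC -/c conjc_real.
rewrite rmorphM rmorphB rmorphM/= -mulc_conjc; ring.
Qed.

Lemma l2_norm_ge0 f : 0 <= l2_norm f.
Proof. exact: sqrtr_ge0. Qed.

Lemma sqr_l2_norm f : l2_norm f ^+ 2 = sqn f.
Proof. by rewrite sqr_sqrtr// sqn_ge0. Qed.

Lemma cauchy_schwarz f h : `|l2_dot f h| <= (l2_norm f * l2_norm h)%:C.
Proof.
rewrite normc_def lecR -ler_sqr ?nnegrE ?mulr_ge0 ?sqrtr_ge0//.
by rewrite sqr_sqrtr ?sqr_mod_ge0// exprMn !sqr_l2_norm cauchy_schwarz_sqr.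
Qed.

Lemma Re_l2_dot_le f h : complex.Re (l2_dot f h) <= l2_norm f * l2_norm h.
Proof.
rewrite -lecR; apply: le_trans (cauchy_schwarz f h).
by apply: le_trans (normc_ge_Re _); rewrite lecR ler_norm.
Qed.

Lemma l2_normD f h : l2_norm (f + h) <= l2_norm f + l2_norm h.
Proof.
rewrite -ler_sqr ?nnegrE ?addr_ge0 ?l2_norm_ge0// sqrrD !sqr_l2_norm.
have -> : sqn (f + h : l2 R T) = sqn f + complex.Re (l2_dot f h) *+ 2 + sqn h.
  apply: (@complexI R); rewrite -l2_dotff l2_dotDl !l2_dotDr !l2_dotff.
  rewrite [l2_dot h f]l2_dotC; case: (l2_dot f h) => u v; simpc => /=.
  by congr (_ +i* _); ring.
by rewrite lerD2r lerD2l lerMn2r Re_l2_dot_le orbT.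
Qed.

Lemma l2_normZ k f : l2_norm (k *: f) = Num.sqrt (sqr_mod k) * l2_norm f.
Proof. by rewrite /l2_norm -/(sqn _) sqnZ sqrtrM// sqr_mod_ge0. Qed.

Lemma l2_norm0 : l2_norm (0 : l2 R T) = 0.
Proof. by rewrite -[0 as X in l2_norm X](scale0r 0) l2_normZ sqr_mod0 sqrtr0 mul0r. Qed.

End Dot.

(** * Adjointable bounded operators and the operator norm *)

Section Adjointable.
Context {R : realType} {T : choiceType}.
Implicit Types (S : l2 R T -> l2 R T) (f h : l2 R T) (k : R[i]).

Definition is_adjoint S S' := forall f h, l2_dot (S f) h = l2_dot f (S' h).

Definition is_bound S (M : R) := forall f, l2_norm (S f) <= M * l2_norm f.

(** Having an adjoint entails linearity ([is_adjoint_linear]), and the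
    condition passes to limits in the operator norm ([adjop_complete]). *)
Definition adjointable : pred (l2 R T -> l2 R T) := fun S =>
  `[< (exists S', is_adjoint S S') /\ exists2 M, 0 <= M & is_bound S M >].

Lemma is_adjoint_sym S S' : is_adjoint S S' -> is_adjoint S' S.
Proof. by move=> SS' f h; rewrite l2_dotC -SS' -l2_dotC. Qed.

(** Linearity is automatic: the inner product is linear in its first argument
    and separates vectors. *)
Lemma is_adjoint_linear S S' : is_adjoint S S' -> linear S.
Proof.
move=> SS' k f f'; apply: l2_dot_inj => h.
by rewrite SS' !l2_dotP !SS'.
Qed.

(** |S' f|^2 = <S S' f, f> <= M |S' f| |f|; divide by |S' f|. *)
Lemma is_bound_adjoint S S' (M : R) : 0 <= M -> is_adjoint S S' -> is_bound S M ->
  is_bound S' M.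
Proof.
move=> M0 SS' SM f.
have [->|S'f0] := eqVneq (l2_norm (S' f)) 0; first by rewrite mulr_ge0 ?l2_norm_ge0.
rewrite -(ler_pM2l (_ : 0 < l2_norm (S' f))); last by rewrite lt_def S'f0 l2_norm_ge0.
rewrite -expr2 sqr_l2_norm -[leLHS]/(complex.Re (sqn (S' f))%:C) -l2_dotff -SS'.
apply: le_trans (Re_l2_dot_le _ _) _.
by rewrite mulrCA mulrA ler_wpM2r ?l2_norm_ge0.
Qed.

Lemma adjointable_submod : submod_closed adjointable.
Proof.
split.
  apply/asboolP; split; first by exists 0 => f h; rewrite l2_dot0l l2_dotC l2_dot0l conjc0.
  by exists 0 => // f; rewrite l2_norm0 mul0r.
move=> k S1 S2 /asboolP[[S1' a1] [M1 M10 b1]] /asboolP[[S2' a2] [M2 M20 b2]].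
apply/asboolP; split.
  exists (fun f => conjc k *: S1' f + S2' f) => f h.
  by rewrite l2_dotP a1 a2 l2_dotDr l2_dotZr conjcK.
exists (Num.sqrt (sqr_mod k) * M1 + M2).
  by rewrite addr_ge0// mulr_ge0// sqrtr_ge0.
move=> f; apply: le_trans (l2_normD _ _) _.
by rewrite mulrDl lerD// l2_normZ -mulrA ler_wpM2l// sqrtr_ge0.
Qed.

HB.instance Definition _ :=
  GRing.isSubmodClosed.Build R[i] (l2 R T -> l2 R T) adjointable
    adjointable_submod.

End Adjointable.

Record adjop (R : realType) (T : choiceType) := Adjop {
  adjop_fun :> l2 R T -> l2 R T ;
  adjop_funP : adjop_fun \in @adjointable R T
}.

Section AdjopSpace.
Context {R : realType} {T : choiceType}.
Implicit Types (S : adjop R T) (f h : l2 R T) (k : R[i]).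

HB.instance Definition _ := [isSub for @adjop_fun R T].
HB.instance Definition _ := [Choice of adjop R T by <:].
HB.instance Definition _ := [SubChoice_isSubLmodule of adjop R T by <:].

Lemma adjopP S S' : (forall f, S f = S' f) -> S = S'.
Proof. by move=> SS'; apply/val_inj/funext. Qed.

(** The infimum is attained ([opnorm_bound]), so [opnorm] is the least bound. *)
Definition opnorm S : R := inf [set M | 0 <= M /\ is_bound S M].

Lemma opnorm_le S M : 0 <= M -> is_bound S M -> opnorm S <= M.
Proof. by move=> M0 SM; apply: ge_inf; [exists 0 => ? [] | split]. Qed.

Lemma bounds_nonempty S : [set M | 0 <= M /\ is_bound S M] !=set0.
Proof. by case/asboolP: (adjop_funP S) => _ [M M0 SM]; exists M. Qed.

Lemma opnorm_ge0 S : 0 <= opnorm S.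
Proof. by apply: lb_le_inf; [exact: bounds_nonempty | move=> ? []]. Qed.

Lemma opnorm_bound S : is_bound S (opnorm S).
Proof.
move=> f; have [f0|f0] := eqVneq (l2_norm f) 0.
  by have [M [_ /(_ f)]] := bounds_nonempty S; rewrite f0 !mulr0.
have {}f0 : 0 < l2_norm f by rewrite lt_def f0 l2_norm_ge0.
rewrite -ler_pdivrMr//; apply: lb_le_inf; first exact: bounds_nonempty.
by move=> M [_ SM]; rewrite ler_pdivrMr.
Qed.

Lemma opnormD S S' : opnorm (S + S') <= opnorm S + opnorm S'.
Proof.
apply: opnorm_le; first by rewrite addr_ge0 ?opnorm_ge0.
move=> f; apply: le_trans (l2_normD _ _) _.
by rewrite mulrDl lerD// opnorm_bound.
Qed.

Lemma opnormZ_le k S : opnorm (k *: S) <= Num.sqrt (sqr_mod k) * opnorm S.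
Proof.
apply: opnorm_le; first by rewrite mulr_ge0 ?sqrtr_ge0 ?opnorm_ge0.
by move=> f; rewrite l2_normZ -mulrA ler_wpM2l ?sqrtr_ge0// opnorm_bound.
Qed.

Lemma opnorm_eq0 S : opnorm S = 0 -> S = 0.
Proof.
move=> S0; apply: adjopP => f; apply: sqn_eq0; rewrite -sqr_l2_norm.
suff -> : l2_norm (S f) = 0 by rewrite expr0n.
by apply/eqP; rewrite eq_le l2_norm_ge0 andbT -[leRHS](mul0r (l2_norm f)) -S0 opnorm_bound.
Qed.

Let normD S S' : (opnorm (S + S'))%:C <= (opnorm S)%:C + (opnorm S')%:C.
Proof. by rewrite -rmorphD lecR opnormD. Qed.

Let normZ k S : (opnorm (k *: S))%:C = `|k| * (opnorm S)%:C.
Proof.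
rewrite normc_def -rmorphM; congr (_%:C); apply/eqP; rewrite eq_le opnormZ_le/=.
have [->|k0] := eqVneq k 0.
  have -> : Num.sqrt (sqr_mod (0 : R[i])) = 0 by rewrite sqr_mod0 sqrtr0.
  by rewrite mul0r opnorm_ge0.
have k1 : 0 < Num.sqrt (sqr_mod k).
  rewrite sqrtr_gt0 lt_def sqr_mod_ge0 andbT.
  by apply: contra_neq k0; exact: sqr_mod_eq0.
rewrite -ler_pdivlMl// -[in leLHS](scalerK k0 S).
apply: le_trans (opnormZ_le _ _) _; rewrite ler_wpM2r ?opnorm_ge0//.
rewrite -[leRHS]mul1r ler_pdivlMr//.
by rewrite -sqrtrM ?sqr_mod_ge0// -sqr_modM mulVf// /sqr_mod /= expr1n expr0n addr0 sqrtr1.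
Qed.

Let norm0 S : (opnorm S)%:C = 0 -> S = 0.
Proof. by move=> [/opnorm_eq0]. Qed.

HB.instance Definition _ :=
  @Lmodule_isNormed.Build R[i] (adjop R T) (fun S => (opnorm S)%:C) normD normZ norm0.

Lemma adjop_normE S : `|S| = (opnorm S)%:C.
Proof. by []. Qed.

End AdjopSpace.

(** * Completeness of the operator norm *)

Section Completeness.
Context {R : realType} {T : choiceType}.
Implicit Types (S U V : adjop R T) (f h : l2 R T).

(** The map [phi] is there to treat the operators ([phi = id]) and their
    adjoints ([phi = adjop_star]) along the same filter.  The limit is taken
    entrywise, in the real and the imaginary part; the estimate for the limit
    is obtained on finite sets of indices, where it passes to the limit, and
    then extends to the whole sum. *)
Lemma adjop_cauchy_limit (F : set_system (adjop R T)) {FF : ProperFilter F}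
    (phi : adjop R T -> adjop R T) :
  (forall e : R, 0 < e -> exists U, F [set V | opnorm (phi U - phi V) < e]) ->
  exists L : l2 R T -> l2 R T, forall U (e : R),
    F [set V | opnorm (phi U - phi V) < e] -> is_bound (fun f => L f - phi U f) e.
Proof.
move=> Fc.
have entry U V f t : sqr_mod ((phi U - phi V) f t) <= (opnorm (phi U - phi V) * l2_norm f) ^+ 2.
  apply: le_trans (sqr_mod_le_sqn _ _) _; rewrite -sqr_l2_norm.
  rewrite ler_sqr ?nnegrE ?mulr_ge0 ?opnorm_ge0 ?l2_norm_ge0//.
  exact: opnorm_bound.
(* [p] stands for the real or the imaginary part; dividing by [l2_norm f + 1]
   instead of [l2_norm f] covers the case [f = 0]. *)
have part_cvg (p : R[i] -> R) f t : (forall z w, p (z - w) = p z - p w) ->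
    (forall z, p z ^+ 2 <= sqr_mod z) -> cvg ((fun V => p (phi V f t)) @ F).
  move=> pB p_le; apply: R_complete; apply: cauchy_exP => e e0.
  have d0 : 0 < e / (l2_norm f + 1) by rewrite divr_gt0// ltr_wpDl ?l2_norm_ge0.
  have [U FU] := Fc _ d0; exists (p (phi U f t)); rewrite /fmap /=.
  apply: filterS FU => V /= UV; rewrite /ball /= -pB.
  rewrite -ltr_sqr ?nnegrE ?(ltW e0)// real_normK ?num_real//.
  apply: le_lt_trans (p_le _) _; apply: le_lt_trans (entry U V f t) _.
  rewrite ltr_sqr ?nnegrE ?(ltW e0) ?mulr_ge0 ?opnorm_ge0 ?l2_norm_ge0//.
  apply: (@le_lt_trans _ _ (opnorm (phi U - phi V) * (l2_norm f + 1))).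
    by rewrite ler_wpM2l ?opnorm_ge0// lerDl.
  by rewrite -ltr_pdivlMr// ltr_wpDl ?l2_norm_ge0.
pose L0 (f : l2 R T) (t : T) : R[i] :=
  lim ((fun V => complex.Re (phi V f t)) @ F) +i* lim ((fun V => complex.Im (phi V f t)) @ F).
have ReL f t : (fun V => complex.Re (phi V f t)) @ F --> complex.Re (L0 f t).
  apply: part_cvg => [[a b] [c d]//|[a b]].
  by rewrite /sqr_mod/= lerDl sqr_ge0.
have ImL f t : (fun V => complex.Im (phi V f t)) @ F --> complex.Im (L0 f t).
  apply: part_cvg => [[a b] [c d]//|[a b]].
  by rewrite /sqr_mod/= lerDr sqr_ge0.
have sqr_cvg (u : adjop R T -> R) (l c : R) : u @ F --> l ->
    (fun V => (u V - c) ^+ 2) @ F --> (l - c) ^+ 2.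
  move=> ul; have ulc : (fun V => u V - c) @ F --> l - c.
    by apply: cvgB ul _; exact: cvg_cst.
  by under eq_fun do rewrite expr2; rewrite expr2; exact: cvgM.
(* On each finite set of indices, the bound on [phi V - phi U] passes to the
   limit in [V]. *)
have L0U U (e : R) f : F [set V | opnorm (phi U - phi V) < e] ->
    (sqr_sum (fun t => L0 f t - phi U f t)%R <= ((e * l2_norm f) ^+ 2)%:E)%E.
  move=> FU; apply: sqr_sum_le => A.
  have sub_Re (z w : R[i]) : complex.Re (z - w) = complex.Re z - complex.Re w.
    by case: z w => [a b] [c d].
  have sub_Im (z w : R[i]) : complex.Im (z - w) = complex.Im z - complex.Im w.
    by case: z w => [a b] [c d].
  have cvA : (fun V => \sum_(t <- A) sqr_mod (phi V f t - phi U f t)) @ F -->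
      \sum_(t <- A) sqr_mod (L0 f t - phi U f t).
    elim: (enum_fset A) => [|t s IH].
      rewrite big_nil; under eq_fun do rewrite big_nil; exact: cvg_cst.
    rewrite big_cons; under eq_fun do rewrite big_cons.
    apply: cvgD => //; rewrite /sqr_mod sub_Re sub_Im.
    have -> : (fun V => complex.Re (phi V f t - phi U f t) ^+ 2 +
        complex.Im (phi V f t - phi U f t) ^+ 2) = (fun V =>
        (complex.Re (phi V f t) - complex.Re (phi U f t)) ^+ 2 +
        (complex.Im (phi V f t) - complex.Im (phi U f t)) ^+ 2).
      by apply/funext => V; rewrite sub_Re sub_Im.
    by apply: cvgD; apply: sqr_cvg; [exact: ReL | exact: ImL].
  rewrite -(cvg_lim (@norm_hausdorff _ R^o) cvA).
  apply: limr_le; first by apply/cvg_ex; eexists; exact: cvA.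
  apply: filterS FU => V /= UV.
  have -> : \sum_(t <- A) sqr_mod (phi V f t - phi U f t) =
      \sum_(t <- A) sqr_mod ((phi U - phi V) f t).
    apply: eq_bigr => t _.
    have -> : (phi U - phi V) f t = phi U f t - phi V f t by [].
    by rewrite -opprB /sqr_mod; case: (_ - _) => x y /=; rewrite !sqrrN.
  apply: le_trans (sum_le_sqn A (l2_lty ((phi U - phi V) f))) _.
  rewrite -sqr_l2_norm ler_sqr ?nnegrE ?mulr_ge0 ?l2_norm_ge0//; last first.
    by rewrite (le_trans _ (ltW UV))// opnorm_ge0.
  apply: le_trans (opnorm_bound (phi U - phi V) f) _.
  by rewrite ler_wpM2r ?l2_norm_ge0// ltW.
have L0_l2 f : exists g : l2 R T, forall t, g t = L0 f t.
  have [U FU] := Fc _ (@ltr01 R).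
  have gP : (fun t => L0 f t - phi U f t : R[i]^o) \in @sqr_summable R T.
    by apply/asboolP; apply: le_lt_trans (L0U _ _ f FU) _; rewrite ltry.
  by exists (L2 gP + phi U f) => t; rewrite /= subrK.
have [L LE] := choice L0_l2.
exists L => U e FU f.
have e0 : 0 <= e.
  have [V /= UV] := filter_ex FU.
  by rewrite (le_trans _ (ltW UV))// opnorm_ge0.
rewrite -ler_sqr ?nnegrE ?mulr_ge0 ?l2_norm_ge0// sqr_l2_norm.
rewrite -lee_fin -sqnE ?l2_lty//; apply: le_trans (L0U _ _ f FU).
by rewrite le_eqVlt; apply/orP; left; apply/eqP; apply: eq_esum => t _; rewrite -LE.
Qed.

End Completeness.

(** * The C*-algebra of adjointable operators *)

Section Algebra.
Context {R : realType} {T : choiceType}.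
Implicit Types (S U V : adjop R T) (f h : l2 R T) (k : R[i]).

Lemma adjop_linear S : linear S.
Proof. by case/asboolP: (adjop_funP S) => -[S' /is_adjoint_linear]. Qed.

Definition build_adjop (S S' : l2 R T -> l2 R T) (SS' : is_adjoint S S')
    (Sb : exists2 M, 0 <= M & is_bound S M) : adjop R T :=
  @Adjop R T S (asboolT (conj (ex_intro _ S' SS') Sb)).

Lemma adjoint_exists S : exists S' : adjop R T, is_adjoint S S'.
Proof.
have [[S' SS'] [M M0 SM]] := asboolW (adjop_funP S).
exists (build_adjop (is_adjoint_sym SS')
  (ex_intro2 _ _ M M0 (is_bound_adjoint M0 SS' SM))).
exact: SS'.
Qed.

Definition adjop_star S : adjop R T := projT1 (cid (adjoint_exists S)).

Lemma adjop_starP S : is_adjoint S (adjop_star S).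
Proof. exact: projT2 (cid (adjoint_exists S)). Qed.

Lemma adjop_star_unique S S' : is_adjoint S S' -> adjop_star S = S'.
Proof.
move=> SS'; apply: adjopP => f; apply: l2_dot_inj => h.
by rewrite l2_dotC -adjop_starP SS' -l2_dotC.
Qed.

Lemma adjop_starK : involutive adjop_star.
Proof. by move=> S; apply: adjop_star_unique; exact/is_adjoint_sym/adjop_starP. Qed.

Lemma adjop_starD : {morph adjop_star : S U / S + U}.
Proof.
move=> S U; apply: adjop_star_unique => f h.
by rewrite [LHS]l2_dotDl [RHS]l2_dotDr !adjop_starP.
Qed.

Lemma adjop_starZ k S : adjop_star (k *: S) = conjc k *: adjop_star S.
Proof.
apply: adjop_star_unique => f h.
by rewrite [LHS]l2_dotZl [RHS]l2_dotZr conjcK adjop_starP.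
Qed.

Lemma adjop_starB S U : adjop_star (S - U) = adjop_star S - adjop_star U.
Proof. by rewrite adjop_starD -scaleN1r adjop_starZ rmorphN1 scaleN1r. Qed.

Lemma opnorm_star S : opnorm (adjop_star S) = opnorm S.
Proof.
suff le S' : opnorm (adjop_star S') <= opnorm S'.
  by apply/eqP; rewrite eq_le le -{1}(adjop_starK S) le.
apply: opnorm_le; first exact: opnorm_ge0.
apply: is_bound_adjoint (adjop_starP _) (@opnorm_bound _ _ _); exact: opnorm_ge0.
Qed.

Let mul_subproof S U : is_adjoint (S \o U) (adjop_star U \o adjop_star S).
Proof. by move=> f h; rewrite /= !adjop_starP. Qed.

Let mul_bound S U : is_bound (S \o U) (opnorm S * opnorm U).
Proof.
move=> f; apply: le_trans (@opnorm_bound _ _ S _) _.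
by rewrite -mulrA ler_wpM2l ?opnorm_ge0// opnorm_bound.
Qed.

Let mul_bounded S U : exists2 M, 0 <= M & is_bound (S \o U) M.
Proof. by exists (opnorm S * opnorm U) => //; rewrite mulr_ge0 ?opnorm_ge0. Qed.

Definition adjop_mul S U : adjop R T :=
  build_adjop (@mul_subproof S U) (@mul_bounded S U).

Lemma opnormM S U : opnorm (adjop_mul S U) <= opnorm S * opnorm U.
Proof. by apply: opnorm_le; rewrite ?mulr_ge0 ?opnorm_ge0//; exact: mul_bound. Qed.

(** The C*-identity: |S f|^2 = <S* S f, f> <= |S* S| |f|^2. *)
Lemma opnorm_star_mul S : opnorm (adjop_mul (adjop_star S) S) = opnorm S ^+ 2.
Proof.
have le1 := opnormM (adjop_star S) S; rewrite opnorm_star -expr2 in le1.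
apply/eqP; rewrite eq_le le1/=.
rewrite -[leRHS]sqr_sqrtr ?opnorm_ge0// ler_sqr ?nnegrE ?sqrtr_ge0 ?opnorm_ge0//.
apply: opnorm_le; first exact: sqrtr_ge0.
move=> f; rewrite -ler_sqr ?nnegrE ?mulr_ge0 ?sqrtr_ge0 ?l2_norm_ge0//.
rewrite exprMn !sqr_l2_norm sqr_sqrtr ?opnorm_ge0//.
rewrite -[leLHS]/(complex.Re (sqn (S f))%:C) -l2_dotff -(is_adjoint_sym (@adjop_starP S)).
apply: le_trans (Re_l2_dot_le _ _) _.
rewrite -sqr_l2_norm expr2 mulrA ler_wpM2r ?l2_norm_ge0//.
exact: (opnorm_bound (adjop_mul (adjop_star S) S)).
Qed.

(** The limits [L] and [L'] of the operators and of their adjoints are adjoint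
    to each other because <L f, h> - <f, L' h> is within
    2 e |f| |h| of <U f, h> - <f, U* h> = 0, for every e > 0. *)
Lemma adjop_complete (F : set_system (adjop R T)) :
  ProperFilter F -> cauchy F -> cvg F.
Proof.
move=> FF /cauchyP Fc.
have Fc1 (e : R) : 0 < e -> exists U, F [set V | opnorm (U - V) < e].
  move=> e0; have [|U FU] := Fc e%:C; first by rewrite ltcR.
  by exists U; apply: filterS FU => V; rewrite -ball_normE /= adjop_normE ltcR.
have Fc2 (e : R) : 0 < e ->
    exists U, F [set V | opnorm (adjop_star U - adjop_star V) < e].
  move=> /Fc1[U FU]; exists U; apply: filterS FU => V /=.
  by rewrite -adjop_starB opnorm_star.
have [L Lb] := @adjop_cauchy_limit _ _ F FF id Fc1.
have [L' L'b] := @adjop_cauchy_limit _ _ F FF adjop_star Fc2.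
have LL' : is_adjoint L L'.
  move=> f h; apply/eqP; rewrite -subr_eq0 -normr_eq0; apply/eqP.
  set z := _ - _.
  have zle (e : R) : 0 < e -> `|z| <= (e * (2 * (l2_norm f * l2_norm h)))%:C.
    move=> e0; have [U FU] := Fc1 e e0.
    have -> : z = l2_dot (L f - U f) h - l2_dot f (L' h - adjop_star U h).
      by rewrite l2_dotBl l2_dotBr adjop_starP /z; ring.
    apply: le_trans (ler_normB _ _) _.
    have -> : e * (2 * (l2_norm f * l2_norm h)) =
      e * l2_norm f * l2_norm h + l2_norm f * (e * l2_norm h) by ring.
    rewrite rmorphD lerD//; apply: le_trans (cauchy_schwarz _ _) _; rewrite lecR.
      by rewrite ler_wpM2r ?l2_norm_ge0//; exact: (Lb _ _ FU f).
    rewrite ler_wpM2l ?l2_norm_ge0//; apply: L'b.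
    by apply: filterS FU => V /=; rewrite -adjop_starB opnorm_star.
  move: zle; rewrite normc_def; set r := Num.sqrt _; set c := 2 * _ => zle.
  have c0 : 0 <= c by rewrite !mulr_ge0 ?l2_norm_ge0.
  congr (_%:C); apply/eqP; rewrite eq_le sqrtr_ge0 andbT leNgt; apply/negP => r0.
  (* With this e, the bound e * c on r is at most r / 2. *)
  have := zle (r / (2 * (c + 1))) (divr_gt0 r0 (mulr_gt0 _ (ltr_wpDl c0 ltr01))).
  rewrite lecR ltr0n => /(_ isT); apply/negP; rewrite -ltNge.
  rewrite mulrAC ltr_pdivrMr ?mulr_gt0 ?ltr_wpDl// ltr_pM2l//; lra.
have Lbounded : exists2 M, 0 <= M & is_bound L M.
  have [U FU] := Fc1 1 ltr01.
  exists (1 + opnorm U); first by rewrite addr_ge0 ?opnorm_ge0.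
  move=> f; rewrite -(subrK (U f) (L f)) mulrDl.
  apply: le_trans (l2_normD _ _) _.
  by apply: lerD; [exact: (Lb _ _ FU f) | exact: (@opnorm_bound _ _ U f)].
apply/cvg_ex; exists (build_adjop LL' Lbounded).
apply/cvg_ballP => e /posc_real[e0 ->].
have [U FU] := Fc1 (complex.Re e / 2) (divr_gt0 e0 (ltr0n _ 2)).
apply: filterS (FU) => V /= UV; rewrite -ball_normE /= adjop_normE ltcR.
rewrite (splitr (complex.Re e)) -(subrKA U); apply: le_lt_trans (opnormD _ _) _.
rewrite ler_ltD//; apply: opnorm_le; first by rewrite ltW// divr_gt0.
exact: (Lb _ _ FU).
Qed.

HB.instance Definition _ := Uniform_isComplete.Build (adjop R T) adjop_complete.

Let mulA : associative adjop_mul.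
Proof. by move=> S U V; apply: adjopP. Qed.

Let mulDl : left_distributive adjop_mul +%R.
Proof. by move=> S U V; apply: adjopP. Qed.

Let mulDr : right_distributive adjop_mul +%R.
Proof.
move=> S U V; apply: adjopP => f.
by have := adjop_linear S 1 (U f) (V f); rewrite !scale1r.
Qed.

Let mulZl k S U : adjop_mul (k *: S) U = k *: adjop_mul S U.
Proof. exact: adjopP. Qed.

Lemma adjop0 S : S 0 = 0.
Proof.
by have := adjop_linear S (-1) 0 0; rewrite scaler0 addr0 scaleN1r addNr.
Qed.

Let mulZr k S U : adjop_mul S (k *: U) = k *: adjop_mul S U.
Proof.
apply: adjopP => f; have := adjop_linear S k (U f) 0.
by rewrite addr0 adjop0 addr0.
Qed.

Let starM S U : adjop_star (adjop_mul S U) = adjop_mul (adjop_star U) (adjop_star S).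
Proof. by apply: adjop_star_unique; exact: mul_subproof. Qed.

Let normM S U : `|adjop_mul S U| <= `|S| * `|U|.
Proof. by rewrite !adjop_normE -rmorphM lecR opnormM. Qed.

Let norm_star S : `|adjop_mul (adjop_star S) S| = `|S| ^+ 2.
Proof. by rewrite !adjop_normE -rmorphXn opnorm_star_mul. Qed.

Definition adjop_algebra : cstarAlgebra R := @CStarAlgebra R (adjop R T)
  adjop_mul adjop_star mulA mulDl mulDr mulZl mulZr adjop_starK adjop_starD
  adjop_starZ starM normM norm_star.

End Algebra.
Arguments adjop_algebra : clear implicits.

(** * Partial isometries induced by partial bijections of the index set *)

Section Shift.
Context {R : realType} {T : choiceType}.
Implicit Types (D E : set T) (e : T -> T) (f h : l2 R T).

(** A partial bijection is encoded by two total maps because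
    [branch_inverse] is total on the orbit. *)
Definition partial_bij D E e e' :=
  (forall z, D z -> E (e z) /\ e' (e z) = z) /\
  (forall y, E y -> D (e' y) /\ e (e' y) = y).

Lemma partial_bij_sym D E e e' : partial_bij D E e e' -> partial_bij E D e' e.
Proof. by case. Qed.

Lemma partial_bij_id D : partial_bij D D id id.
Proof. by []. Qed.

Definition pullback D e (f : T -> R[i]) : T -> R[i] :=
  fun z => if z \in D then f (e z) else 0.

Lemma sqr_sum_pullback D E e e' (f : T -> R[i]) : partial_bij D E e e' ->
  sqr_sum (pullback D e f) = (\esum_(y in E) (sqr_mod (f y))%:E)%E.
Proof.
move=> [De Ee].
rewrite (@reindex_esum _ _ _ D E e); last first.
  split=> [z /De[]//|z w /set_mem Dz /set_mem Dw zw|y /Ee[De'y ee'y]].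
    by rewrite -(De z Dz).2 zw (De w Dw).2.
  by exists (e' y).
rewrite esum_mkcond; apply: eq_esum => z _; rewrite /pullback.
by case: ifP => // _; rewrite sqr_mod0.
Qed.

Lemma sqr_sum_pullback_le D E e e' (f : T -> R[i]) : partial_bij D E e e' ->
  (sqr_sum (pullback D e f) <= sqr_sum f)%E.
Proof.
move=> /sqr_sum_pullback ->; rewrite esum_mkcond; apply: le_esum => y _.
by case: ifP => // _; rewrite lee_fin sqr_mod_ge0.
Qed.

Lemma shift_subproof D E e e' (DE : partial_bij D E e e') f :
  (pullback D e f : T -> R[i]^o) \in @sqr_summable R T.
Proof. by apply/asboolP; apply: le_lt_trans (sqr_sum_pullback_le f DE) (l2_lty f). Qed.

Definition shift_fun D E e e' (DE : partial_bij D E e e') f : l2 R T :=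
  L2 (shift_subproof DE f).

Lemma shift_fun_linear D E e e' (DE : partial_bij D E e e') : linear (shift_fun DE).
Proof.
move=> k f h; apply: l2P => z.
rewrite -[RHS]/(k * pullback D e f z + pullback D e h z) /= /pullback.
by case: ifP => // _; rewrite mulr0 addr0.
Qed.

Lemma shift_fun_bound D E e e' (DE : partial_bij D E e e') : is_bound (shift_fun DE) 1.
Proof.
move=> f; rewrite mul1r ler_sqrt ?sqn_ge0//.
by rewrite -lee_fin -!sqnE ?l2_lty//; exact: sqr_sum_pullback_le DE.
Qed.

(** The inner product is a combination of squared norms, so linear maps with the
    same squared norms have the same inner products. *)
Lemma linear_sqn_dot (S S' : l2 R T -> l2 R T) f h : linear S -> linear S' ->
  (forall u, sqn (S u) = sqn (S' u)) -> l2_dot (S f) (S h) = l2_dot (S' f) (S' h).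
Proof.
move=> Slin S'lin SS'.
have q k : sqn (S f + k *: S h : l2 R T) = sqn (S' f + k *: S' h : l2 R T).
  by rewrite addrC -Slin SS' S'lin addrC.
have := (q 1, q (-1), q 'i, q (- 'i)).
rewrite !scale1r !scaleN1r !scaleNr => -[[[q1 q2] q3] q4].
by rewrite !l2_dot_polar q1 q2 q3 q4.
Qed.

Lemma shift_fun_isometry D E e e' (DE : partial_bij D E e e') f h :
  l2_dot (shift_fun DE f) (shift_fun DE h) =
  l2_dot (shift_fun (partial_bij_id E) f) (shift_fun (partial_bij_id E) h).
Proof.
apply: linear_sqn_dot => [||u]; try exact: shift_fun_linear.
rewrite /sqn; congr fine.
by rewrite (sqr_sum_pullback u DE) (sqr_sum_pullback u (partial_bij_id E)).
Qed.

(** Here the two families of products agree term by term. *)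
Lemma mask_fun_adjoint E :
  is_adjoint (shift_fun (partial_bij_id E)) (shift_fun (partial_bij_id E)).
Proof.
move=> f h; apply: (congr1 (fun u : T -> R[i]^o => summability.sum u)).
apply/funext => t; rewrite /= /pullback.
by case: ifP; rewrite ?conjc0 ?mulr0 ?mul0r.
Qed.

(** With P and Q the two shifts and 1_D, 1_E the masks, P Q = 1_D, and P
    preserves the inner product of vectors supported in E.  Therefore
    <P f, h> = <P f, 1_D h> = <P f, P Q h> = <1_E f, 1_E Q h> = <f, Q h>. *)
Lemma shift_fun_adjoint D E e e' (DE : partial_bij D E e e') :
  is_adjoint (shift_fun DE) (shift_fun (partial_bij_sym DE)).
Proof.
move=> f h; set P := shift_fun DE; set Q := shift_fun _.
pose mask X := shift_fun (partial_bij_id X).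
have maskP u : mask D (P u) = P u.
  by apply: l2P => z; rewrite /mask /P /= /pullback; case: (z \in D).
have maskQ u : mask E (Q u) = Q u.
  by apply: l2P => z; rewrite /mask /Q /= /pullback; case: (z \in E).
have PQ u : P (Q u) = mask D u.
  apply: l2P => z; rewrite /mask /P /Q /= /pullback; case: ifPn => // /set_mem /DE.1[Ez ->].
  by rewrite mem_set.
rewrite -maskP mask_fun_adjoint -/(mask D) -PQ shift_fun_isometry.
by rewrite mask_fun_adjoint -/(mask E) !maskQ.
Qed.

Definition shift_op D E e e' (DE : partial_bij D E e e') : adjop R T :=
  build_adjop (shift_fun_adjoint DE) (ex_intro2 _ _ 1 ler01 (shift_fun_bound DE)).

Definition mask D : adjop R T := shift_op (partial_bij_id D).

Lemma shift_opE D E e e' (DE : partial_bij D E e e') f z :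
  shift_op DE f z = if z \in D then f (e z) else 0.
Proof. by []. Qed.

Lemma maskE D f z : mask D f z = if z \in D then f z else 0.
Proof. by []. Qed.

Lemma shift_op_delta D E e e' (DE : partial_bij D E e e') y :
  shift_op DE (l2_delta y) = (\1_E y : R[i]) *: l2_delta (e' y).
Proof.
apply: l2P => z; rewrite shift_opE -[RHS]/(\1_E y * (z == e' y)%:R) /= indicE.
case: ifPn => [/set_mem Dz|zD].
  case: (eqVneq (e z) y) => [<-|ezy].
    by rewrite mem_set ?(DE.1 z Dz).2 ?eqxx ?mulr1//; case: (DE.1 z Dz).
  case: (boolP (y \in E)) => [/set_mem Ey|_]; rewrite ?mul0r// mul1r.
  by case: (eqVneq z (e' y)) ezy => [->|//]; rewrite (DE.2 y Ey).2 eqxx.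
case: (boolP (y \in E)) => [/set_mem Ey|_]; rewrite ?mul0r// mul1r.
case: (eqVneq z (e' y)) zD => [-> /negP[]|//].
by rewrite mem_set//; case: (DE.2 y Ey).
Qed.

Lemma mask_delta D y : mask D (l2_delta y) = (\1_D y : R[i]) *: l2_delta y.
Proof. exact: shift_op_delta. Qed.

Lemma shift_op_star D E e e' (DE : partial_bij D E e e') :
  adjop_star (shift_op DE) = shift_op (partial_bij_sym DE).
Proof. by apply: adjop_star_unique; exact: shift_fun_adjoint. Qed.

Lemma mask_star D : adjop_star (mask D) = mask D.
Proof. by apply: adjop_star_unique; exact: mask_fun_adjoint. Qed.

Lemma mask_mul D E : adjop_mul (mask D) (mask E) = mask (D `&` E).
Proof.
apply: adjopP => f; apply: l2P => z; rewrite [LHS]maskE !maskE in_setI.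
by case: (z \in D).
Qed.

Lemma mask0 : mask set0 = 0.
Proof. by apply: adjopP => f; apply: l2P => z; rewrite maskE in_set0. Qed.

Lemma mask_setU D E : mask (D `|` E) = mask D + mask E - mask (D `&` E).
Proof.
apply: adjopP => f; apply: l2P => z.
rewrite -[RHS]/(mask D f z + mask E f z - mask (D `&` E) f z) !maskE in_setU in_setI.
by case: (z \in D); case: (z \in E); rewrite /= ?addrK ?subr0 ?addr0 ?add0r.
Qed.

Lemma mask_setD D E : E `<=` D -> mask (D `\` E) = mask D - mask E.
Proof.
move=> ED; apply: adjopP => f; apply: l2P => z.
rewrite -[RHS]/(mask D f z - mask E f z) !maskE in_setD.
case: (boolP (z \in E)) => [/set_mem/ED/mem_set ->|_].
  by rewrite andbF subrr.
by rewrite andbT subr0.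
Qed.

Lemma shift_mul_star D E e e' (DE : partial_bij D E e e') :
  adjop_mul (shift_op DE) (adjop_star (shift_op DE)) = mask D.
Proof.
rewrite shift_op_star; apply: adjopP => f; apply: l2P => z.
rewrite [LHS]shift_opE maskE; case: ifPn => // /set_mem /DE.1[Ez ze].
by rewrite shift_opE mem_set// ze.
Qed.

Lemma shift_star_mul D E e e' (DE : partial_bij D E e e') :
  adjop_mul (adjop_star (shift_op DE)) (shift_op DE) = mask E.
Proof. by rewrite -[RHS](shift_mul_star (partial_bij_sym DE)) -shift_op_star adjop_starK. Qed.

Lemma mask_shift D E e e' (DE : partial_bij D E e e') :
  adjop_mul (mask D) (shift_op DE) = shift_op DE.
Proof.
apply: adjopP => f; apply: l2P => z; rewrite [LHS]maskE !shift_opE.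
by case: (z \in D).
Qed.

(** The coefficients of the adjoint are <S* d_y, d_z> = <d_y, S d_z>, where d
    is the basis, and S f is recovered from <S f, d_y> = <f, S* d_y>. *)
Lemma adjop_delta_inj (S U : adjop R T) :
  (forall y, S (l2_delta y) = U (l2_delta y)) -> S = U.
Proof.
move=> SU; apply: adjopP => f; apply: l2P => y.
rewrite -!l2_dot_delta !adjop_starP; congr (l2_dot f _); apply: l2P => z.
rewrite -[LHS]l2_dot_delta -[RHS]l2_dot_delta.
by rewrite !(is_adjoint_sym (@adjop_starP _ _ _)) SU.
Qed.

End Shift.

(** * Representations as *-homomorphisms into the operator algebra *)

Section Representations.
Context {R : realType} {T : choiceType} {A : cstarAlgebra R}.

Lemma bounded_operator_eq (S U : bounded_operator R T) : (forall f, S f = U f) -> S = U.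
Proof.
case: S U => [S ? ?] [U ? ?] /= SU; have {}SU : S = U by exact/funext.
by subst U; congr BoundedOperator; exact: Prop_irrelevance.
Qed.

Definition adjop_bounded (S : adjop R T) : bounded_operator R T :=
  BoundedOperator (adjop_linear S) (ex_intro _ (opnorm S) (@opnorm_bound _ _ S)).

Lemma star_hom_representation (phi : A -> adjop_algebra R T) : is_star_hom phi ->
  is_star_representation (fun a => adjop_bounded (phi a)).
Proof.
case=> philin phiM phiS; split=> /=.
- by move=> a b f; have := philin 1 a b; rewrite !scale1r => ->.
- by move=> k a f; have := philin k a 0; have := philin (-1) a a;
    rewrite !scaleN1r !addNr => ->; rewrite !addr0 => ->.
- by move=> a b f; rewrite phiM.
- by move=> a f h; rewrite phiS; exact: adjop_starP.
Qed.

(** The operators of a *-representation have adjoints, namely the images of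
    the adjoint elements. *)
Lemma representation_star_hom (nu : A -> bounded_operator R T) :
  is_star_representation nu ->
  exists2 phi : A -> adjop_algebra R T, is_star_hom phi & forall a f, phi a f = nu a f.
Proof.
case=> nuD nuZ nuM nuS.
have nub a : exists2 M, 0 <= M & is_bound (nu a) M.
  have [M aM] := bop_bounded (nu a); exists `|M| => // f.
  by apply: le_trans (aM f) _; rewrite ler_wpM2r ?l2_norm_ge0// ler_norm.
exists (fun a => build_adjop (nuS a) (nub a)) => //; split.
- by move=> k a b; apply: adjopP => f; rewrite -[LHS]/(nu _ f) nuD nuZ.
- by move=> a b; apply: adjopP => f; exact: nuM.
- by move=> a; apply/esym/adjop_star_unique; exact: nuS.
Qed.

End Representations.

(** * The ultragraph family on the orbit of an escaping point *)

Section MarkovOrbit.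
Context {R : realType}.
Variables (a : R) (b : \bar R) (lo hi : nat -> R) (g : R -> R).
Hypothesis hg : markov_class a b lo hi g.
Local Notation piece := (piece lo hi).
Local Notation dom := (markov_dom lo hi).

Lemma interior_piece n : (piece n)° = [set t | lo n < t < hi n].
Proof.
rewrite (_ : piece n = [set` `[lo n, hi n]]); last first.
  by apply/seteqP; split => t; rewrite /= in_itv.
rewrite interior_itv_bnd.
by apply/seteqP; split => t; rewrite /= in_itv.
Qed.

Lemma piece_ltn i j : (i < j)%N -> hi i <= lo j.
Proof.
elim: j => // j IH; rewrite ltnS leq_eqVlt => /predU1P[->|ij].
  exact: piece_ordered hg j.
apply: le_trans (IH ij) _; apply: le_trans (piece_nonempty hg j) _.
exact: piece_ordered hg j.
Qed.

Lemma interior_piece_unique i j t : (piece i)° t -> piece j t -> i = j.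
Proof.
rewrite interior_piece => /andP[it ti] /andP[jt tj].
case: (ltngtP i j) => // [/piece_ltn|/piece_ltn] ij.
  by have := lt_le_trans ti (le_trans ij jt); rewrite ltxx.
by have := lt_le_trans it (le_trans tj ij); rewrite ltxx.
Qed.

Lemma escape_set_notin_dom j t : escape_set lo hi j t -> ~ dom t.
Proof.
move=> /andP[jt tj] [n _ /andP[nt tn]].
case: (ltngtP n j) => [/piece_ltn nj|jn|nj]; last by move: jt; rewrite -nj ltNge tn.
  have := lt_le_trans (le_lt_trans (le_trans nj (piece_nonempty hg j)) jt) tn.
  by rewrite ltxx.
move: jn; rewrite leq_eqVlt => /predU1P[jn|/piece_ltn jn].
  by move: tj; rewrite jn ltNge nt.
have := le_lt_trans (le_trans (le_trans (piece_nonempty hg j.+1) jn) nt) tj.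
by rewrite ltxx.
Qed.

Lemma boundary_piece_sub n : boundary (piece n) `<=` piece n.
Proof.
move=> t [nt _]; have pcl : closed (piece n).
  rewrite (_ : piece n = [set` `[lo n, hi n]]); first exact: itv_closed.
  by apply/seteqP; split => u; rewrite /= in_itv.
by rewrite ((closure_id _).1 pcl).
Qed.

Lemma markov_boundary_iter n t : markov_boundary lo hi t ->
  markov_boundary lo hi (iter n g t).
Proof.
move=> bt; elim: n => //= n IH.
by apply: (markov_boundary_stable hg); exists (iter n g t).
Qed.

Variable x : R.
Hypothesis hx : escaping_points lo hi g x.
Local Notation orb := (escape_orbit lo hi g x).

Lemma escape_time_notin_dom : ~ dom (iter (escape_time lo hi g x) g x).
Proof.
have [k /= k0 [xk [j _ /escape_set_notin_dom xj]]] := hx.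
suff : is_escape_time lo hi g x (escape_time lo hi g x) by case.
by rewrite /escape_time; case: xgetP => [? -> //|/(_ k)[]]; split=> //; apply: xk; rewrite prednK.
Qed.

(** Otherwise the point is on the boundary, which is invariant under g and
    contained in the domain, so its iterates would never leave the domain. *)
Lemma orbit_interior (y : orb) j : piece j (set_val y) -> (piece j)° (set_val y).
Proof.
move=> jy; apply: contrapT => jy'; apply: escape_time_notin_dom.
have [_ [n [_ _ <-]]] := set_valP y.
have /(markov_boundary_iter n)[m _ /boundary_piece_sub] :
  markov_boundary lo hi (set_val y).
  by exists j => //; split => //; exact: subset_closure.
by exists m.
Qed.

Lemma orbit_piece_unique (y : orb) i j : piece i (set_val y) -> piece j (set_val y) -> i = j.
Proof. by move=> /orbit_interior; exact: interior_piece_unique. Qed.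

(** The orbit is closed under preimages, which makes the branch inverses act
    on it. *)
Lemma orbit_preimage t (y : orb) : dom t -> g t = set_val y -> orb t.
Proof.
move=> tdom ty; split=> //; have [_ [n [n0 yn nx]]] := set_valP y.
exists n.+1; split => //; last by rewrite iterSr ty.
by move=> [//|k]; rewrite ltnS iterSr ty; exact: yn.
Qed.

Definition orbit_part (B : set nat) : set orb :=
  [set y : orb | union_pieces lo hi B (set_val y)].

Definition edge_domain i : set orb :=
  orbit_part (@range_set (markov_ultragraph lo hi g) i).

Definition edge_image i : set orb :=
  [set z : orb | piece i (set_val z) /\
     exists2 y, edge_domain i y & g (set_val z) = set_val y].

(** g on the orbit; a point that g sends out of the orbit is mapped to itself,
    but no such point belongs to any [edge_image]. *)
Definition orbit_step (z : orb) : orb := xget z [set y : orb | set_val y = g (set_val z)].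

Lemma orbit_stepE (z y : orb) : g (set_val z) = set_val y -> orbit_step z = y.
Proof.
move=> zy; apply/val_inj; rewrite /orbit_step; case: xgetP => [u _ /=|/(_ y)[]//].
by rewrite zy.
Qed.

(** A point of a piece in the range of the edge is interior to it, hence the
    image of an interior point of piece [i], and that point is in the orbit. *)
Lemma branch_inverseP i (y : orb) : edge_domain i y ->
  piece i (set_val (branch_inverse i y)) /\ g (set_val (branch_inverse i y)) = set_val y.
Proof.
move=> [j ij /orbit_interior/ij[t it ty]].
have it' : piece i t := interior_subset it.
have torb : orb t by apply: orbit_preimage ty; exists i.
rewrite /branch_inverse; case: xgetP => [z _ //|/(_ (exist _ t (mem_set torb)))[]].
by split.
Qed.

(** Two preimages in piece [i] are both interior, and g is injective there. *)
Lemma branch_bij i : partial_bij (edge_image i) (edge_domain i) orbit_step (branch_inverse i).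
Proof.
split=> [z [iz [y iy zy]]|y iy]; last first.
  have [iz zy] := branch_inverseP iy; split; last exact: orbit_stepE.
  by split => //; exists y.
rewrite (orbit_stepE zy); split => //; apply/val_inj.
have [iz' zy'] := branch_inverseP iy.
apply: (markov_inj hg (n := i)); rewrite ?inE; try exact: orbit_interior.
by rewrite zy zy'.
Qed.

Definition orbit_edge i : adjop_algebra R orb := shift_op (branch_bij i).
Definition orbit_proj (B : set nat) : adjop_algebra R orb := mask (orbit_part B).

Lemma orbit_part_vertex i (z : orb) : piece i (set_val z) -> orbit_part [set i] z.
Proof. by exists i. Qed.

Lemma orbit_partI X Y : orbit_part (X `&` Y) = orbit_part X `&` orbit_part Y.
Proof.
apply/seteqP; split=> z; first by move=> [i [Xi Yi] iz]; split; exists i.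
move=> [[i Xi iz] [j Yj jz]]; exists i => //; split => //.
by rewrite (orbit_piece_unique iz jz).
Qed.

Lemma orbit_partU X Y : orbit_part (X `|` Y) = orbit_part X `|` orbit_part Y.
Proof.
apply/seteqP; split=> z; first by move=> [i [?|?] iz]; [left|right]; exists i.
by move=> [|] [i ? iz]; exists i => //; [left|right].
Qed.

Lemma orbit_part0 : orbit_part set0 = set0.
Proof. by apply/seteqP; split=> // z []. Qed.

(** The initial and final projections of [orbit_edge i] are the masks of
    [edge_domain i] and [edge_image i].  The images are disjoint for distinct
    edges since each of them lies in its own piece. *)
Lemma orbit_family :
  @ultragraph_family R (markov_ultragraph lo hi g) (adjop_algebra R orb)
    orbit_edge orbit_proj.
Proof.
split.
- move=> e; rewrite /is_partial_isometry /= shift_mul_star; exact: mask_shift.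
- move=> e f ef /=; rewrite !shift_mul_star mask_mul.
  rewrite (_ : _ `&` _ = set0) ?mask0//; apply/seteqP; split=> // z [[ez _] [fz _]].
  exact: (ef (orbit_piece_unique ez fz)).
- by move=> X _; split; [rewrite /= mask_mul setIid | exact: mask_star].
- by rewrite /orbit_proj orbit_part0 mask0.
- by move=> X Y _ _; rewrite /= mask_mul /orbit_proj orbit_partI.
- by move=> X Y _ _; rewrite /orbit_proj orbit_partU orbit_partI; exact: mask_setU.
- by move=> e /=; rewrite shift_star_mul.
(* A difference of nested projections is a projection q, hence q* q. *)
- move=> e /=; exists (mask (orbit_part [set e] `\` edge_image e)) => /=.
  rewrite shift_mul_star mask_star mask_mul setIid; apply/esym/mask_setD.
  by move=> z [/orbit_part_vertex].
Qed.

End MarkovOrbit.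

Theorem theorem5p6 (R : realType) (a : R) (b : \bar R) (hab : (a%:E < b)%E)
  (lo hi : nat -> R) (g : R -> R) (hg : markov_class a b lo hi g)
  (x : R) (hx : escaping_points lo hi g x)
  (A : cstarAlgebra R)
  (s : edge (markov_ultragraph lo hi g) -> A)
  (p : set (vertex (markov_ultragraph lo hi g)) -> A)
  (hA : is_ultragraph_algebra s p) :
  exists! nu : A -> bounded_operator R (escape_orbit lo hi g x),
    [/\ is_star_representation nu,
        forall B : set (vertex (markov_ultragraph lo hi g)),
          gen_vertex_set B -> is_W B (nu (p B)) &
        forall i, is_T i (nu (s i))].
Proof.
have [phi [[phi_hom phi_s phi_p] phi_unique]] := hA.2 _ _ _ (orbit_family hg hx).
exists (fun a => adjop_bounded (phi a)); split.
  split; first exact: star_hom_representation.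
    by move=> B GB y; rewrite /= phi_p//; exact: mask_delta.
  by move=> i y; rewrite /= phi_s; exact: shift_op_delta.
move=> nu [/representation_star_hom[psi psi_hom psiE] nu_p nu_s].
have phi_psi : phi = psi.
  apply: phi_unique; split => // [i|B GB]; apply: adjop_delta_inj => y; rewrite psiE.
    by rewrite nu_s; apply/esym; exact: shift_op_delta.
  by rewrite nu_p//; apply/esym; exact: mask_delta.
apply/funext => c; apply: bounded_operator_eq => f.
by rewrite /= phi_psi psiE.
Qed.
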